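(* Let $k\ge1$ and let $L$ be the negative $(2,2k)$-torus link (the closure of the 2-strand braid $\sigma_1^{-2k}$), with both components colored by the same color. Then the tail of the colored Jones polynomial of $L$ exists and equals $$T_L(q)=\Psi(q^{2k-1},q).$$
   Context: The false theta function is $\Psi(a,b)=\sum_{k=0}^{\infty}a^{k(k+1)/2}b^{k(k-1)/2}-\sum_{k=1}^{\infty}a^{k(k-1)/2}b^{k(k+1)/2}$. $J_{N,L}(q)$ denotes the colored Jones polynomial of a link $L$ associated to the $N$-dimensional irreducible representation of $U_q(\mathfrak{sl}_2)$ (all components colored by $N$), normalized so that $J_{N,\text{unknot}}=1$; $J_{2,L}$ is the Jones polynomial. For a Laurent polynomial $P$ (possibly in $q^{1/2}$) and a power series $S$, write $P\doteq_n S$ if there exist a sign $\varepsilon$ and an exponent $s$ such that $\varepsilon q^{s}P(q)$ is a power series in $q$ that is congruent to $S(q)$ modulo $q^n$. The tail of $L$ is a power series $T_L(q)=\sum_{j\ge0}a_jq^j$ with $J_{N,L}(q)\doteq_N T_L(q)$ for every $N\ge1$. *)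

(* Defs.v *)
From HB Require Import structures.
From mathcomp Require Import all_boot all_order all_algebra.
Unset Printing Implicit Defensive.
Import Order.TTheory GRing.Theory Num.Theory.
Local Open Scope ring_scope.

(* Coefficient field: rational functions in a formal variable X, where X
   stands for q^(1/4).  Laurent polynomials in q^(1/2) live inside it. *)
Definition F : fieldType := {fraction {poly int}}.

Definition Xq : F := tofrac ('X : {poly int}).

(* The quantum-group parameter used in the R-matrix: w = q^(-1/4), so that
   J_{2,L}(q) = V_L(t) at t = q (Jones' convention; sigma_1 = positive crossing). *)
Definition wq : F := Xq^-1.
Definition wpow (z : int) : F := wq ^ z.

(* quantum integer [n] = (v^n - v^-n)/(v - v^-1) with v = w^2 *)
Definition qint (n : nat) : F :=
  \sum_(i < n) wpow (2 * ((n%:Z - 1) - 2 * (i : nat)%:Z)).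

Definition qfact (n : nat) : F := \prod_(1 <= i < n.+1) qint i.

(* N-dimensional irreducible U_q(sl_2)-module V_N, basis e_0..e_{N-1}:
     K e_j = v^(N-1-2j) e_j,  F e_j = e_{j+1},  E e_j = [j][N-j] e_{j-1}.
   Universal R-matrix  R = v^(H(x)H/2) sum_n v^(n(n-1)/2) (v - v^-1)^n/[n]! E^n (x) F^n,
   braiding  Rc = P o R  on V_N (x) V_N.
   Rcoef N i j a b = coefficient of e_a (x) e_b in Rc (e_i (x) e_j). *)
Definition Rcoef (N i j a b : nat) : F :=
  if (a + b == i + j)%N && (j <= a)%N then
    let n := (a - j)%N in
    (\prod_(t < n) (qint (i - t) * qint (N - i + t)))
    * wpow (n%:Z * (n%:Z - 1))
    * (wpow 2 - wpow (-2)) ^+ n / qfact n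
    * wpow ((N%:Z - 1 - 2 * b%:Z) * (N%:Z - 1 - 2 * a%:Z))
  else 0.

(* V_N (x) V_N indexed by 'I_(N*N), x <-> (x %/ N, x %% N). Column y = image of
   basis vector y. *)
Definition Rmat (N : nat) : 'M[F]_(N * N) :=
  \matrix_(x < N * N, y < N * N) Rcoef N (y %/ N) (y %% N) (x %/ N) (x %% N).

Definition braidpow (N : nat) (m : int) : 'M[F]_(N * N) :=
  match m with
  | Posz n => iter n (mulmx (Rmat N)) (1%:M : 'M[F]_(N * N))
  | Negz n => iter n.+1 (mulmx (invmx (Rmat N))) (1%:M : 'M[F]_(N * N))
  end.

(* quantum trace: tr((K (x) K) A) *)
Definition qtrace (N : nat) (A : 'M[F]_(N * N)) : F :=
  \sum_(x < N * N)
     wpow (2 * ((N%:Z - 1 - 2 * (x %/ N)%:Z) + (N%:Z - 1 - 2 * (x %% N)%:Z))) * A x x.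

(* Colored Jones polynomial J_{N,L}(q) of the closure L of the 2-braid sigma_1^m,
   all components colored by V_N, framing-corrected by the twist
   theta = v^((N^2-1)/2) per crossing, normalized so J_{N,unknot} = 1. *)
Definition cjones_2braid (N : nat) (m : int) : F :=
  wpow (- (m * ((N * N)%:Z - 1))) * qtrace N (braidpow N m) / qint N.

(* P =._n S : exist a sign eps and an exponent s in (1/2)Z (written q^(s'/2),
   i.e. X^(2 s')) such that eps q^s P is a power series p(q) in q with
   p = S mod q^n. *)
Definition doteq (n : nat) (P : F) (S : nat -> int) : Prop :=
  exists (eps : bool) (s : int) (p : {poly int}),
    (-1) ^+ eps * Xq ^ (2 * s) * P = tofrac (p \Po 'X^4)
    /\ forall i : nat, (i < n)%N -> p`_i = S i.

(* Coefficient of q^i in the false theta function Psi(q^a, q^b)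
   = sum_{m>=0} q^(a m(m+1)/2 + b m(m-1)/2) - sum_{m>=1} q^(a m(m-1)/2 + b m(m+1)/2).
   (Each exponent is >= m-1 when a + b >= 1, so m < i+2 suffices.) *)
Definition psi_coef (a b : nat) (i : nat) : int :=
  \sum_(0 <= m < i.+2) (nat_of_bool (a * 'C(m.+1, 2) + b * 'C(m, 2) == i)%N)%:Z
  - \sum_(1 <= m < i.+2) (nat_of_bool (a * 'C(m, 2) + b * 'C(m.+1, 2) == i)%N)%:Z.

(* Main.v *)
Require Import Defs.
From HB Require Import structures.
From mathcomp Require Import all_boot all_order all_algebra.
From mathcomp Require Import zify ring.
Import Order.TTheory GRing.Theory Num.Theory.
Local Open Scope ring_scope.

(** Write [N = n+1]. On the vectors [e_i (x) e_j] of weight [i + j = s <= n] the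
    braiding is a block [B_s] of size [s+1]. The coproduct of F intertwines
    [B_s] with [B_(s+1)] and has an image of codimension one, so a functional
    killing this image is a left eigenvector of [B_(s+1)]; its eigenvalue can be
    read off on [e_0 (x) e_(s+1)], which the braiding sends to a multiple of
    [e_(s+1) (x) e_0]. Hence [tr B_(s+1)^-m = tr B_s^-m + lambda_(s+1)^-m]. The
    weights above [n] are reduced to those below by the rescaled flip
    [e_i (x) e_j |-> e_(n-j) (x) e_(n-i)]. Abel summation of the quantum trace
    then gives, up to a power of [q],
      [J_N = sum_(c < N) q^(k c(c+1) - c) (1 - q^(2c+1)) / (1 - q^N)],
    where the numerator vanishes modulo [1 - q^N] because its terms cancel in
    pairs [c <-> N-1-c], and the denominator does not affect the coefficients
    below [q^N]. *)

(** * Quantum integers and the intertwining relation *)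

Lemma Xq_neq0 : Xq != 0.
Proof. by rewrite /Xq tofrac_eq0 polyX_eq0. Qed.

Lemma wq_neq0 : wq != 0.
Proof. by rewrite /wq invr_eq0 Xq_neq0. Qed.

Lemma wpowD x y : wpow (x + y) = wpow x * wpow y.
Proof. by rewrite /wpow expfzDr ?wq_neq0. Qed.

Lemma wpowN x : wpow (- x) = (wpow x)^-1.
Proof. by rewrite /wpow -invr_expz. Qed.

Lemma wpow0 : wpow 0 = 1.
Proof. by []. Qed.

Lemma wpow_neq0 x : wpow x != 0.
Proof. by rewrite /wpow expfz_neq0 ?wq_neq0. Qed.

Lemma wpow_exp x m : wpow x ^+ m = wpow (x * m%:Z).
Proof. by rewrite /wpow exprnP exprz_exp. Qed.

Lemma wpow_tofrac (m : nat) : wpow (- m%:Z) = tofrac ('X^m : {poly int}).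
Proof. by rewrite wpowN /wpow /wq -exprnP exprVn invrK /Xq tofracXn. Qed.

Lemma wpow_neq1 (m : nat) : (0 < m)%N -> wpow m%:Z != 1.
Proof.
move=> m0; rewrite -[wpow _]invrK -wpowN wpow_tofrac -[X in _ != X]invr1 (inj_eq invr_inj).
rewrite -tofrac1 tofrac_eq; apply/eqP => /(congr1 (fun p : {poly int} => size p)).
by rewrite size_polyXn size_poly1 => -[] m00; rewrite m00 in m0.
Qed.

(* Otherwise unification unfolds [F] down to fractions of integer polynomials. *)
Opaque F wpow.

Definition vdiff : F := wpow 2 - wpow (-2).

Lemma wpow_sub_neq0 (m : nat) : (0 < m)%N -> wpow m%:Z - wpow (- m%:Z) != 0.
Proof.
move=> m0; rewrite subr_eq0 wpowN; apply/eqP => e.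
have := wpow_neq1 (m + m) ltac:(lia).
by rewrite PoszD wpowD {2}e mulfV ?wpow_neq0 // eqxx.
Qed.

Lemma vdiff_neq0 : vdiff != 0.
Proof. exact: (wpow_sub_neq0 2). Qed.

Lemma qint_vdiff n : qint n * vdiff = wpow (2 * n%:Z) - wpow (- (2 * n%:Z)).
Proof.
rewrite /qint mulr_suml.
pose f (i : nat) := - wpow (2 * (n%:Z - 2 * i%:Z)).
rewrite (eq_bigr (fun i : 'I_n => f i.+1 - f i)); last first.
  move=> i _; rewrite /f /vdiff mulrBr -!wpowD opprK addrC; congr (- wpow _ + wpow _); lia.
rewrite -(big_mkord xpredT (fun i => f i.+1 - f i)) telescope_sumr // /f.
rewrite opprK addrC; congr (wpow _ - wpow _); lia.
Qed.

Lemma qintE n : qint n = (wpow (2 * n%:Z) - wpow (- (2 * n%:Z))) / vdiff.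
Proof. by rewrite -qint_vdiff mulfK // vdiff_neq0. Qed.

Lemma qint_neq0 n : (0 < n)%N -> qint n != 0.
Proof.
move=> n0; rewrite qintE; apply: mulf_neq0; last by rewrite invr_eq0 vdiff_neq0.
rewrite -[2 * n%:Z](PoszM 2); apply: wpow_sub_neq0; by rewrite muln_gt0.
Qed.

Lemma qint0 : qint 0 = 0.
Proof. by rewrite /qint big_ord0. Qed.

Lemma qfactS n : qfact n.+1 = qfact n * qint n.+1.
Proof. by rewrite /qfact big_nat_recr. Qed.

Lemma qfact0 : qfact 0 = 1.
Proof. by rewrite /qfact big_geq. Qed.

Opaque vdiff qint qfact.

Lemma qfact_neq0 n : qfact n != 0.
Proof.
elim: n => [|n IH]; first by rewrite qfact0 oner_eq0.
by rewrite qfactS; apply: mulf_neq0 IH (qint_neq0 _ _).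
Qed.

(** Naming the order [n] of the term [E^n (x) F^n] removes the conditional and the truncated
    subtraction [a - j]. *)
Lemma Rcoef_shift N i j a b n : a = (j + n)%N -> i = (b + n)%N ->
  Rcoef N i j a b = (\prod_(t < n) (qint (i - t) * qint (N - i + t)))
    * wpow (n%:Z * (n%:Z - 1)) * vdiff ^+ n / qfact n
    * wpow ((N%:Z - 1 - 2 * b%:Z) * (N%:Z - 1 - 2 * a%:Z)).
Proof.
move=> -> ->; rewrite /Rcoef leq_addr addKn.
have -> : (j + n + b == b + n + j)%N by apply/eqP; lia.
reflexivity.
Qed.

Lemma Rcoef_eq0 N i j a b : ~~ ((a + b == i + j)%N && (j <= a)%N) -> Rcoef N i j a b = 0.
Proof. by rewrite /Rcoef => /negbTE ->. Qed.

Lemma prod_qint_recl N i n : (i < N)%N ->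
  \prod_(t < n.+1) (qint (i.+1 - t) * qint (N - i.+1 + t)) =
  qint i.+1 * qint (N - i.+1) * \prod_(t < n) (qint (i - t) * qint (N - i + t)).
Proof.
move=> iN; rewrite big_ord_recl /= subn0 addn0; congr (_ * _).
apply: eq_bigr => t _; rewrite /bump /=; congr (qint _ * qint _); lia.
Qed.

(* [h = v - v^-1], [P = v^i], [Q = v^N], [M = v^n]. *)
Lemma intertwine_core (K : fieldType) (h v P Q M : K) : 
  h != 0 -> v != 0 -> P != 0 -> Q != 0 -> M != 0 ->
  v / Q * P ^+ 2 * ((M * v - (M * v)^-1) / h)
   + (P * v - (P * v)^-1) / h * ((Q / (P * v) - (Q / (P * v))^-1) / h) * M * h
  = (P / M - (P / M)^-1) / h * ((Q / P * M - (Q / P * M)^-1) / h) * M * h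
    + (M * v - (M * v)^-1) / h * (Q / (v * P ^+ 2) * M ^+ 2).
Proof. by move=> *; field; repeat (apply/andP; split). Qed.

(** Separates the denominators [[n]!] and [[n+1]!] from the four-term identity to which the
    intertwining relation reduces. *)
Lemma intertwine_common_factor (K : fieldType) (C f g h Q q W x y z m t : K) :
  Q != 0 -> q != 0 -> x * q + y * m * h = z * m * h + q * t ->
  x * (C * f * g / Q * W) + y * C * (f * m) * (h * g) / (Q * q) * W
  = C * z * (f * m * (h * g) / (Q * q) * W) + C * f * g / Q * (W * t).
Proof.
move=> Q0 q0 e.
transitivity (C * f * g / (Q * q) * W * (x * q + y * m * h)).
  by field; rewrite Q0 q0.
by rewrite e; field; rewrite Q0 q0.
Qed.

(** Entry form of the commutation of the braiding with the coproduct of F: the left side lowers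
    first, the right side braids first. The two conditionals discard preimages outside the basis. *)
Lemma Rcoef_intertwine N s i a : (s.+1 < N)%N -> (i <= s)%N -> (a <= s.+1)%N ->
  wpow (- (2 * (N%:Z - 1 - 2 * i%:Z))) * Rcoef N i (s.+1 - i) a (s.+1 - a)
    + Rcoef N i.+1 (s.+1 - i.+1) a (s.+1 - a)
  = (if (a <= s)%N then
       wpow (- (2 * (N%:Z - 1 - 2 * a%:Z))) * Rcoef N i (s - i) a (s - a) else 0)
    + (if (0 < a)%N then Rcoef N i (s - i) a.-1 (s - a.-1) else 0).
Proof.
move=> sN le_is le_as.
have [lt_a|] := ltnP a (s - i).
  rewrite !Rcoef_eq0 ?mulr0 ?add0r ?negb_and -?ltnNge; try by apply/orP; right; lia.
  by rewrite !if_same addr0.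
(* On the boundary [a = s - i] only the two terms of order 0 survive. *)
rewrite leq_eqVlt => /orP [/eqP ea|lt_a].
  rewrite (Rcoef_eq0 _ i (s.+1 - i)); last by rewrite negb_and -ltnNge; apply/orP; right; lia.
  rewrite mulr0 add0r.
  have -> : (a <= s)%N by lia.
  rewrite [X in _ = _ + X](_ : _ = 0); last first.
    by case: ifP => // a0; apply: Rcoef_eq0; rewrite negb_and -ltnNge; apply/orP; right; lia.
  rewrite addr0 (Rcoef_shift _ i.+1 _ _ _ 0) ?(Rcoef_shift _ i _ _ _ 0); try lia.
  rewrite !big_ord0 !mul1r !qfact0 !invr1 !mul1r -!wpowD; congr wpow.
  have -> : (s.+1 - a = (s - a) .+1)%N by lia.
  rewrite [(s - a).+1%:Z]intS; ring.
(* In the generic case the four terms have orders [n], [n+1], [n+1], [n] in [E (x) F]. *)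
have [n en] : exists n, a = (s - i + n.+1)%N by exists (a - (s - i)).-1; lia.
have ni : (n <= i)%N by lia.
rewrite (Rcoef_shift _ i (s.+1 - i) _ _ n); try lia.
rewrite (Rcoef_shift _ i.+1 _ _ _ n.+1); try lia.
have -> : (0 < a)%N by lia.
rewrite (Rcoef_shift _ i _ a.-1 _ n); try lia.
rewrite prod_qint_recl; last lia.
set C := \prod_(t < n) _.
(* For [a = s+1] this term is absent; the formula still holds because then [n = i] and [[i - n] =
   0]. *)
rewrite [X in _ = X + _](_ : _ = C * (qint (i - n) * qint (N - i + n)) *
  (wpow (n.+1%:Z * (n.+1%:Z - 1)) * vdiff ^+ n.+1 / qfact n.+1
    * wpow ((N%:Z - 1 - 2 * (s.+1 - a)%N%:Z) * (N%:Z - 1 - 2 * a%:Z)))); last first.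
  case: ifP => [le_as'|gt_as]; last first.
    have -> : (i - n = 0)%N by lia.
    by rewrite qint0 !(mul0r, mulr0).
  rewrite (Rcoef_shift _ i _ a _ n.+1); try lia.
  rewrite big_ord_recr /= -/C.
  have -> : (s.+1 - a = (s - a).+1)%N by lia.
  rewrite [(s-a).+1%:Z]intS.
  set W1 := wpow ((_ - 2 * (s - a)%N%:Z) * _); set W2 := wpow ((_ - 2 * _) * _).
  have -> : W2 = wpow (- (2 * (N%:Z - 1 - 2 * a%:Z))) * W1.
    by rewrite -wpowD; congr wpow; ring.
  ring.
have -> : wpow (n.+1%:Z * (n.+1%:Z - 1)) = wpow (n%:Z * (n%:Z - 1)) * wpow (2 * n%:Z).
  by rewrite -wpowD; congr wpow; rewrite intS; ring.
have -> : wpow ((N%:Z - 1 - 2 * (s - a.-1)%N%:Z) * (N%:Z - 1 - 2 * a.-1%:Z)) =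
   wpow ((N%:Z - 1 - 2 * (s.+1 - a)%N%:Z) * (N%:Z - 1 - 2 * a%:Z)) *
   wpow (2 * (N%:Z - 1 - 2 * (i%:Z - n%:Z))).
  have -> : (s - a.-1 = i - n)%N by lia.
  have -> : (s.+1 - a = i - n)%N by lia.
  have {2}-> : a = a.-1.+1 by lia.
  rewrite -wpowD intS -(subzn ni); congr wpow; ring.
set W := wpow ((N%:Z - 1 - 2 * (s.+1 - a)%N%:Z) * _).
rewrite qfactS exprS.
have core : wpow (- (2 * (N%:Z - 1 - 2 * i%:Z))) * qint n.+1
     + qint i.+1 * qint (N - i.+1) * wpow (2 * n%:Z) * vdiff =
   qint (i - n) * qint (N - i + n) * wpow (2 * n%:Z) * vdiff
     + qint n.+1 * wpow (2 * (N%:Z - 1 - 2 * (i%:Z - n%:Z))).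
  rewrite !qintE.
  have := intertwine_core F vdiff (wpow 2) (wpow (2 * i%:Z)) (wpow (2 * N%:Z)) (wpow (2 * n%:Z))
     vdiff_neq0 (wpow_neq0 _) (wpow_neq0 _) (wpow_neq0 _) (wpow_neq0 _).
  rewrite !wpow_exp; repeat (rewrite -wpowD || rewrite -wpowN); move=> core.
  have e1 : ((N - i.+1)%N%:Z = N%:Z - i%:Z - 1) by lia.
  have e2 : ((N - i + n)%N%:Z = N%:Z - i%:Z + n%:Z) by lia.
  rewrite e1 e2 -(subzn ni) !intS.
  etransitivity; last (etransitivity; first exact: core); last first.
  - congr ((wpow _ - wpow _) / _ * ((wpow _ - wpow _) / _) * _ * _
      + (wpow _ - wpow _) / _ * wpow _); ring.
  - congr (wpow _ * ((wpow _ - wpow _) / _)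
      + (wpow _ - wpow _) / _ * ((wpow _ - wpow _) / _) * _ * _); ring.
exact: intertwine_common_factor (qfact_neq0 n) (qint_neq0 n.+1 isT) core.
Qed.

(** * Traces of inverse powers on the weight blocks *)

(** Same iteration as the negative branch of [braidpow], for matrices of any size. *)
Definition invmx_exp {K : fieldType} {n : nat} (A : 'M[K]_n) (m : nat) : 'M[K]_n :=
  iter m (mulmx (invmx A)) 1%:M.

Lemma invmx_intertwine (K : fieldType) m n (A : 'M[K]_m) (B : 'M[K]_n) (J : 'M[K]_(m, n)) :
  A \in unitmx -> B \in unitmx -> A *m J = J *m B -> invmx A *m J = J *m invmx B.
Proof.
move=> uA uB e; rewrite -[LHS]mulmx1 -(mulmxV uB) mulmxA -[_ *m J *m B]mulmxA -e.
by rewrite mulmxA mulVmx ?mul1mx.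
Qed.

Lemma invmx_exp_intertwine (K : fieldType) m n (A : 'M[K]_m) (B : 'M[K]_n) (J : 'M[K]_(m, n)) k :
  A \in unitmx -> B \in unitmx -> A *m J = J *m B ->
  invmx_exp A k *m J = J *m invmx_exp B k.
Proof.
move=> uA uB e; elim: k => [|k IH] /=; first by rewrite mulmx1 mul1mx.
by rewrite -mulmxA IH mulmxA (invmx_intertwine _ _ _ _ _ _ uA uB e) mulmxA.
Qed.

Lemma invmx_exp_eigen (K : fieldType) n (A : 'M[K]_n) (f : 'rV[K]_n) (l : K) k :
  A \in unitmx -> f != 0 -> f *m A = l *: f -> f *m invmx_exp A k = (l ^- k) *: f.
Proof.
move=> uA f0 e.
have l0 : l != 0.
  apply: contra f0 => /eqP l0.
  by rewrite -[f]mulmx1 -(mulmxV uA) mulmxA e l0 scale0r mul0mx.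
have e1 : f *m invmx A = l^-1 *: f.
  by rewrite -[in LHS](scale1r f) -(mulVf l0) -scalerA -e -scalemxAl mulmxK.
elim: k => [|k IH] /=; first by rewrite mulmx1 expr0 invr1 scale1r.
by rewrite mulmxA e1 -scalemxAl IH scalerA exprS invfM.
Qed.

(* The rows of the inverse of [row_mx u P] are a functional [f] vanishing on
   the image of [P] and a left inverse [G] of [P]; as [1 = u f + P G], the
   trace splits along the flag [im P < K^(1+n)]. *)
Lemma mxtrace_invmx_exp_codim1 (K : fieldType) n (u : 'cV[K]_(1 + n)) (P : 'M[K]_(1 + n, n))
    (A : 'M[K]_(1 + n)) (B : 'M[K]_n) (l : K) :
    row_mx u P \in unitmx -> A \in unitmx -> B \in unitmx -> A *m P = P *m B ->
    (forall f : 'rV[K]_(1 + n), f *m P = 0 -> f *m u = 1%:M -> f *m A *m u = l%:M) ->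
  forall k, \tr (invmx_exp A k) = l ^- k + \tr (invmx_exp B k).
Proof.
move=> uS uA uB AP fAu k.
set S := row_mx u P in uS; set f := usubmx (invmx S); set G := dsubmx (invmx S).
have e1 : u *m f + P *m G = 1%:M by rewrite -mul_row_col vsubmxK mulmxV.
have : block_mx (f *m u) (f *m P) (G *m u) (G *m P) = block_mx 1%:M 0 0 1%:M.
  by rewrite -mul_col_row vsubmxK mulVmx // scalar_mx_block.
case/eq_block_mx => fu fP _ GP.
have fA : f *m A = l *: f.
  rewrite -[LHS]mulmx1 -e1 mulmxDr !mulmxA (fAu _ fP fu) mul_scalar_mx.
  by rewrite -[f *m A *m P]mulmxA AP mulmxA fP !mul0mx addr0.
have f0 : f != 0.
  apply/eqP => f0; move: fu; rewrite f0 mul0mx => /matrixP /(_ 0 0).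
  by rewrite !mxE eqxx => /eqP; rewrite eq_sym oner_eq0.
rewrite -[invmx_exp A k]mulmx1 -e1 mulmxDr linearD /= !mulmxA; congr (_ + _).
  rewrite mxtrace_mulC mulmxA (invmx_exp_eigen _ _ _ _ _ _ uA f0 fA) -scalemxAl fu.
  by rewrite /mxtrace big_ord1 !mxE eqxx mulr1.
rewrite (invmx_exp_intertwine _ _ _ _ _ _ _ uA uB AP) mxtrace_mulC mulmxA GP mul1mx.
by [].
Qed.

Lemma sum_ord_delta (K : fieldType) n (c : nat) (f : nat -> K) :
  \sum_(b < n) (if b == c :> nat then f b else 0) = if (c < n)%N then f c else 0.
Proof. by rewrite -big_mkcond /= big_ord1_eq. Qed.

(** Basis [e_i (x) e_(s-i)]; for [s < N] it spans the whole weight space of index sum [s]. *)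
Definition weight_block (N s : nat) : 'M[F]_s.+1 :=
  \matrix_(a < s.+1, i < s.+1) Rcoef N i (s - i) a (s - a).

Definition lowering_coef (N i : nat) : F := wpow (- (2 * (N%:Z - 1 - 2 * i%:Z))).

(* Coproduct of F: e_i (x) e_j |-> v^(-(N-1-2i)) e_i (x) e_(j+1) + e_(i+1) (x) e_j *)
Definition lowering (N s : nat) : 'M[F]_(1 + s.+1, s.+1) :=
  \matrix_(a < 1 + s.+1, i < s.+1)
    ((if a == i :> nat then lowering_coef N i else 0) + (if a == i.+1 :> nat then 1 else 0)).

Definition top_vec (s : nat) : 'cV[F]_(1 + s.+1) := delta_mx 0 0.

Lemma weight_block_lowering N s : (s.+1 < N)%N ->
  (weight_block N s.+1 : 'M_(1 + s.+1)) *m lowering N s = lowering N s *m weight_block N s.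
Proof.
move=> sN; apply/matrixP => a i; rewrite !mxE.
have le_is : (i <= s)%N by rewrite -ltnS.
have le_as : (a <= s.+1)%N by rewrite -ltnS.
transitivity (lowering_coef N i * Rcoef N i (s.+1 - i) a (s.+1 - a)
    + Rcoef N i.+1 (s.+1 - i.+1) a (s.+1 - a)).
  under eq_bigr => b _ do rewrite !mxE mulrDr.
  rewrite big_split /=; congr (_ + _).
    under eq_bigr => b _ do rewrite (fun_if ( *%R _)) mulr0.
    rewrite (sum_ord_delta _ _ _ (fun b => Rcoef N b (s.+1 - b) a (s.+1 - a) * lowering_coef N i)).
    by rewrite ltnS leqW // mulrC.
  under eq_bigr => b _ do rewrite (fun_if ( *%R _)) mulr0 mulr1.
  by rewrite (sum_ord_delta _ _ _ (fun b => Rcoef N b (s.+1 - b) a (s.+1 - a))) !ltnS le_is.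
rewrite (Rcoef_intertwine _ _ _ _ sN le_is le_as).
under [RHS]eq_bigr => b _ do rewrite !mxE mulrDl.
rewrite big_split /=; congr (_ + _).
  under eq_bigr => b _ do rewrite [(a == b :> nat)]eq_sym (fun_if ( *%R^~ _)) mul0r.
  by rewrite (sum_ord_delta _ _ _ (fun b => lowering_coef N b * Rcoef N i (s - i) b (s - b))) ltnS.
under eq_bigr => b _ do rewrite (fun_if ( *%R^~ _)) mul0r mul1r.
case: (posnP a) => [a0|a0].
  by rewrite big1 // => b _; rewrite a0.
rewrite (eq_bigr (fun b : 'I_s.+1 => if b == a.-1 :> nat then Rcoef N i (s - i) b (s - b) else 0)).
  rewrite (sum_ord_delta _ _ _ (fun b => Rcoef N i (s - i) b (s - b))).
  by have -> : (a.-1 < s.+1)%N by lia.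
by move=> b _; congr (if _ then _ else _); apply/eqP/eqP; lia.
Qed.

(** Putting [e_0 (x) e_(s+1)] in front of the columns of [lowering] gives an upper bidiagonal matrix
    with ones on the diagonal. *)
Lemma lowering_unitmx N s : row_mx (top_vec s) (lowering N s) \in unitmx.
Proof.
rewrite -unitmx_tr unitmxE det_trig; last first.
  apply/is_trig_mxP => i j; rewrite mxE.
  case: (split_ordP i) => k -> /=; rewrite ?row_mxEl ?row_mxEr !mxE ?ord1 /=.
    by move=> j0; rewrite (_ : (j == 0) = false) //; apply/eqP => e; rewrite e in j0.
  move=> lt_kj; rewrite !ifF ?addr0 //; apply/eqP; lia.
rewrite big1 ?unitr1 // => i _; rewrite mxE.
case: (split_ordP i) => k -> /=; rewrite ?row_mxEl ?row_mxEr !mxE ?ord1 /=; first by [].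
by rewrite ifF ?ifT ?add0r //; apply/eqP; lia.
Qed.

(** The scalar by which the braiding acts on the summand of dimension [2N - 1 - 2s] of
    [V_N (x) V_N]. *)
Definition R_eigenvalue (N s : nat) : F :=
  (-1) ^+ s * wpow ((N%:Z - 1) * (N%:Z - 1 - 2 * s%:Z) - 2 * s%:Z * (N%:Z - s%:Z)).

(** Vanishing on column [i] of [lowering] is the recursion [f_(i+1) = - lowering_coef N i * f_i],
    started at [f_0 = 1]. *)
Lemma coinvariant_coef N s (f : 'rV[F]_(1 + s.+1)) (i : 'I_s.+2) :
  f *m lowering N s = 0 -> f *m top_vec s = 1%:M ->
  f 0 i = (-1) ^+ i * wpow (- (2 * i%:Z * (N%:Z - i%:Z))).
Proof.
move=> fP fu.
have f0 : f 0 0 = 1.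
  move/matrixP: fu => /(_ 0 0); by rewrite /top_vec -colE !mxE eqxx.
case: i => i; elim: i => [|i IH] lt_i.
  by rewrite expr0 mulr0 mul0r oppr0 mul1r -[RHS]f0; congr (f _ _); apply: val_inj.
have lt_i' : (i < s.+2)%N by rewrite ltnW.
have lt_is : (i < s.+1)%N by [].
move/matrixP: fP => /(_ 0 (Ordinal lt_is)); rewrite !mxE.
under eq_bigr => b _ do rewrite !mxE mulrDr /=.
rewrite (bigD1 (Ordinal lt_i')) // (bigD1 (Ordinal lt_i)) /=; last first.
  by apply/eqP => -[]; lia.
rewrite eqxx [i == i.+1]ltn_eqF // [i.+1 == i]gtn_eqF // !mulr0 addr0 add0r eqxx mulr1.
rewrite big1 ?addr0; last first.
  move=> b /andP [/eqP b1 /eqP b2].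
  rewrite !ifF ?mulr0 ?addr0 //; apply/eqP => e.
    by apply: b2; apply: val_inj.
  by apply: b1; apply: val_inj.
rewrite IH => /eqP; rewrite addrC addr_eq0 => /eqP ->.
rewrite exprS mulN1r mulNr /lowering_coef; congr (- _).
rewrite -[LHS]mulrA -wpowD intS /=; congr (_ * wpow _); ring.
Qed.

(** As [E e_0 = 0], only the entry at [e_(s+1) (x) e_0] contributes. Its [H (x) H] factor gives the
    first summand of the exponent in [R_eigenvalue]; the coefficient of [f] gives the sign and the
    second summand. *)
Lemma coinvariant_eigenvalue N s (f : 'rV[F]_(1 + s.+1)) :
  f *m lowering N s = 0 -> f *m top_vec s = 1%:M ->
  f *m (weight_block N s.+1 : 'M_(1 + s.+1)) *m top_vec s = (R_eigenvalue N s.+1)%:M.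
Proof.
move=> fP fu; apply/matrixP => a b; rewrite !ord1 /top_vec -colE !mxE eqxx mulr1n.
rewrite (bigD1 ord_max) //= big1 ?addr0.
  rewrite (coinvariant_coef _ _ _ _ fP fu) mxE /= subn0 subnn.
  rewrite (Rcoef_shift _ 0 _ _ _ 0) ?addn0 // big_ord0 qfact0 invr1 !mul1r.
  rewrite -[LHS]mulrA -wpowD /R_eigenvalue; congr (_ * wpow _).
  rewrite intS; ring.
move=> i /eqP i_max; rewrite mxE Rcoef_eq0 ?mulr0 //= subn0 negb_and -ltnNge.
apply/orP; right; rewrite ltn_neqAle -ltnS ltn_ord andbT.
by apply/eqP => e; apply: i_max; apply: val_inj.
Qed.

Lemma mxtrace_weight_blockS N s m : (s.+1 < N)%N ->
    weight_block N s \in unitmx -> weight_block N s.+1 \in unitmx ->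
  \tr (invmx_exp (weight_block N s.+1) m) =
    R_eigenvalue N s.+1 ^- m + \tr (invmx_exp (weight_block N s) m).
Proof.
move=> sN u1 u2.
apply: (@mxtrace_invmx_exp_codim1 _ s.+1 _ _ _ _ _ (lowering_unitmx N s) u2 u1 (weight_block_lowering _ _ sN)).
exact: coinvariant_eigenvalue.
Qed.

(** Each step of the induction adds one eigenvalue. The invertibility of the blocks is supplied
    later by [diag_low], from that of [Rmat]. *)
Lemma mxtrace_weight_block N s m : (s < N)%N ->
    (forall r, (r <= s)%N -> weight_block N r \in unitmx) ->
  \tr (invmx_exp (weight_block N s) m) = \sum_(r < s.+1) R_eigenvalue N r ^- m.
Proof.
elim: s => [|s IH] sN u; last first.
  rewrite mxtrace_weight_blockS ?u // (IH (ltnW sN) (fun r rs => u r (leqW rs))).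
  by rewrite [RHS]big_ord_recr /= addrC.
rewrite big_ord1 /=.
have eb : weight_block N 0 = (R_eigenvalue N 0)%:M.
  apply/matrixP => a b; rewrite !ord1 !mxE eqxx mulr1n /=.
  rewrite (Rcoef_shift _ 0 _ _ _ 0) // big_ord0 qfact0 invr1 !mul1r /R_eigenvalue mul1r; congr wpow.
  by rewrite subn0 !mulr0 mul0r !subr0.
have -> : invmx_exp (weight_block N 0) m = (R_eigenvalue N 0 ^- m)%:M.
  elim: m => [|m IH] /=; first by rewrite expr0 invr1.
  by rewrite IH eb invmx_scalar -scalar_mxM -invfM -exprS.
by rewrite mxtrace_scalar.
Qed.

(** * Weight decomposition of the braiding *)

Lemma idx_subproof N (a b : 'I_N) : (a * N + b < N * N)%N.
Proof.
apply: (@leq_trans (a * N + N)); first by rewrite ltn_add2l.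
by rewrite addnC -mulSn leq_mul2r ltn_ord orbT.
Qed.

Definition idx {N} (a b : 'I_N) : 'I_(N * N) := Ordinal (idx_subproof N a b).

Lemma idx_div N (a b : 'I_N) : (idx a b %/ N = a)%N.
Proof. by rewrite /= divnMDl ?divn_small ?addn0 // (leq_trans _ (ltn_ord b)). Qed.

Lemma idx_mod N (a b : 'I_N) : (idx a b %% N = b)%N.
Proof. by rewrite /= modnMDl modn_small. Qed.

Lemma ltn_div_sq N (x : 'I_(N * N)) : (x %/ N < N)%N.
Proof. by rewrite ltn_divLR //; case: N x => [[]|]. Qed.

Lemma ltn_mod_sq N (x : 'I_(N * N)) : (x %% N < N)%N.
Proof. by rewrite ltn_mod; case: N x => [[]|]. Qed.

Lemma eq_idx N (x : 'I_(N * N)) (a b : 'I_N) : (x %/ N = a)%N -> (x %% N = b)%N -> x = idx a b.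
Proof. by move=> ea eb; apply: val_inj; rewrite /= -ea -eb -divn_eq. Qed.

Definition swap_idx N (x : 'I_(N * N)) : 'I_(N * N) :=
  idx (Ordinal (ltn_mod_sq N x)) (Ordinal (ltn_div_sq N x)).

Lemma swap_idxK N : involutive (swap_idx N).
Proof.
move=> x; apply/esym/eq_idx.
  by rewrite -[RHS]/(swap_idx N x %% N)%N idx_mod.
by rewrite -[RHS]/(swap_idx N x %/ N)%N idx_div.
Qed.

(** Undoing the flip leaves the R-matrix itself, which moves index from the first factor to the
    second and is thus triangular in lexicographic order, with powers of [w] on the diagonal. *)
Lemma Rmat_unitmx N : Rmat N \in unitmx.
Proof.
pose s := perm.perm (inv_inj (swap_idxK N)).
suff : row_perm s (Rmat N) \in unitmx by rewrite row_permE unitmx_mul => /andP [].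
have e x y : row_perm s (Rmat N) x y = Rcoef N (y %/ N) (y %% N) (x %% N) (x %/ N).
  by rewrite !mxE perm.permE idx_div idx_mod.
rewrite -unitmx_tr unitmxE det_trig; last first.
  apply/is_trig_mxP => x y lt_xy; rewrite mxE e Rcoef_eq0 //.
  apply/negP => /andP [/eqP es le_m].
  have := leq_div2r N (ltnW lt_xy); have := divn_eq x N; have := divn_eq y N.
  move: lt_xy es le_m; move: (x %/ N)%N (x %% N)%N (y %/ N)%N (y %% N)%N => a b c d.
  move=> lt_xy es le_m ey ex le_ac.
  have ac : a = c by lia.
  have bd : b = d by lia.
  by move: lt_xy; rewrite ex ey ac bd ltnn.
rewrite unitfE; apply/prodf_neq0 => x _; rewrite mxE e.
rewrite (Rcoef_shift _ _ _ _ _ 0) ?addn0 // big_ord0 qfact0 invr1 !mul1r.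
exact: wpow_neq0.
Qed.

(** The embedding [J] of the coordinates [f], rescaled by [d], intertwines [B] with [R] and has the
    left inverse [L]. So [L R^-1 J] inverts [B], and the scalars [d] cancel on the diagonal. *)
Lemma diag_block (K : fieldType) m s (R : 'M[K]_m) (B : 'M[K]_s)
    (f : 'I_s -> 'I_m) (d : 'I_s -> K) :
    R \in unitmx -> injective f -> (forall k, d k != 0) ->
    (forall l k, R (f l) (f k) * d k = d l * B l k) ->
    (forall x k, (forall l, x != f l) -> R x (f k) = 0) ->
  B \in unitmx /\ forall p k, invmx_exp R p (f k) (f k) = invmx_exp B p k k.
Proof.
move=> uR f_inj d0 RB R0.
pose J := \matrix_(x < m, k < s) (if x == f k then d k else 0).
pose L := \matrix_(k < s, x < m) (if x == f k then (d k)^-1 else 0).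
have mulJ t (A : 'M_(t, m)) a k : (A *m J) a k = A a (f k) * d k.
  rewrite !mxE (bigD1 (f k)) //= !mxE eqxx big1 ?addr0 // => x /negbTE xk.
  by rewrite mxE xk mulr0.
have Jmul t (A : 'M_(s, t)) l k : (J *m A) (f l) k = d l * A l k.
  rewrite !mxE (bigD1 l) //= !mxE eqxx big1 ?addr0 // => x xk.
  by rewrite mxE (inj_eq f_inj) eq_sym (negbTE xk) mul0r.
have LJ : L *m J = 1%:M.
  apply/matrixP => l k; rewrite mulJ !mxE (inj_eq f_inj) eq_sym.
  by case: eqP => [->|_]; rewrite ?mul0r // mulVf.
have RJ : R *m J = J *m B.
  apply/matrixP => x k; case: (pickP (fun l => x == f l)) => [l /eqP ->|xf].
    by rewrite mulJ Jmul RB.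
  rewrite mulJ R0 => [|l]; last by rewrite xf.
  rewrite mul0r !mxE big1 // => l _.
  by rewrite mxE xf mul0r.
have uB : B \in unitmx.
  have : (L *m invmx R *m J) *m B = 1%:M.
    by rewrite -mulmxA -RJ mulmxA mulmxKV.
  by case/mulmx1_unit.
split=> // p k; apply: (mulIf (d0 k)).
by rewrite -mulJ (invmx_exp_intertwine _ _ _ _ _ _ _ uR uB RJ) Jmul mulrC.
Qed.

Definition low_idx n s (k : 'I_s.+1) : 'I_(n.+1 * n.+1) := idx (inord k) (inord (s - k)).
(** Mirror image of [low_idx] under [e_i (x) e_j |-> e_(n-j) (x) e_(n-i)], hence of index sum
    [2n - s]. *)
Definition high_idx n s (k : 'I_s.+1) : 'I_(n.+1 * n.+1) :=
  idx (inord (n - (s - k))) (inord (n - k)).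

Lemma low_idxE n s k : (s <= n)%N ->
  ((low_idx n s k %/ n.+1 = k)%N * (low_idx n s k %% n.+1 = s - k)%N)%type.
Proof. by move=> sn; have := ltn_ord k; split; rewrite ?idx_div ?idx_mod inordK //; lia. Qed.

Lemma high_idxE n s k : (s <= n)%N ->
  ((high_idx n s k %/ n.+1 = n - (s - k))%N * (high_idx n s k %% n.+1 = n - k)%N)%type.
Proof. by move=> sn; have := ltn_ord k; split; rewrite ?idx_div ?idx_mod inordK //; lia. Qed.

Lemma low_idx_inj n s : (s <= n)%N -> injective (low_idx n s).
Proof.
move=> sn k l e; apply: val_inj => /=.
by rewrite -(low_idxE n s k sn).1 e (low_idxE n s l sn).1.
Qed.

Lemma high_idx_inj n s : (s <= n)%N -> injective (high_idx n s).
Proof.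
move=> sn k l e; apply: val_inj => /=; have := (high_idxE n s k sn).2.
by rewrite e (high_idxE n s l sn).2; have := ltn_ord k; have := ltn_ord l; lia.
Qed.

Lemma eq_low_idx n s (x : 'I_(n.+1 * n.+1)) : (s <= n)%N ->
  (x %/ n.+1 + x %% n.+1 = s)%N -> x = low_idx n s (inord (x %/ n.+1)).
Proof.
move=> sn e; apply: eq_idx; rewrite !inordK //; lia.
Qed.

Lemma eq_high_idx n s (x : 'I_(n.+1 * n.+1)) : (s <= n)%N ->
  (x %/ n.+1 + x %% n.+1 + s = n + n)%N -> x = high_idx n s (inord (n - x %% n.+1)).
Proof.
move=> sn e; have := ltn_div_sq _ x; have := ltn_mod_sq _ x => h1 h2.
apply: eq_idx; rewrite !inordK //; lia.
Qed.

Lemma diag_low n s : (s <= n)%N ->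
  weight_block n.+1 s \in unitmx /\
  forall p k, invmx_exp (Rmat n.+1) p (low_idx n s k) (low_idx n s k)
              = invmx_exp (weight_block n.+1 s) p k k.
Proof.
move=> sn; apply: (diag_block _ _ _ _ _ _ (fun=> 1)) => //.
- exact: Rmat_unitmx.
- exact: low_idx_inj.
- by move=> k; apply: oner_neq0.
- by move=> l k; rewrite mul1r mulr1 !mxE !low_idxE.
move=> x k xf; rewrite mxE !low_idxE // Rcoef_eq0 //.
apply/negP => /andP [/eqP e _]; have /eqP := xf (inord (x %/ n.+1)); apply.
by apply: eq_low_idx => //; rewrite e subnKC // -ltnS.
Qed.

(** The coefficient of [e_0] in [E^j e_j]. Rescaled by it, the reversal [e_j |-> e_(N-1-j)]
    exchanges E and F. *)
Definition qbinom_scale (N j : nat) : F := \prod_(t < j) (qint t.+1 * qint (N - t.+1)).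

Lemma qbinom_scale_add N j m :
  qbinom_scale N (j + m) =
  qbinom_scale N j * \prod_(t < m) (qint (j + t).+1 * qint (N - (j + t).+1)).
Proof. by rewrite /qbinom_scale big_split_ord. Qed.

Lemma qbinom_scale_neq0 N j : (j < N)%N -> qbinom_scale N j != 0.
Proof.
move=> jN; apply/prodf_neq0 => t _; have := ltn_ord t => tj.
by apply: mulf_neq0; apply: qint_neq0; lia.
Qed.

(** With [a = j + m] and [i = b + m], the product of quantum integers in [Rcoef] is the ratio of the
    scales at [i] and [b], and the flipped product is the ratio at [a] and [j]; the remaining
    factors are symmetric. *)
Lemma Rcoef_flip n i j a b : (i <= n)%N -> (j <= n)%N -> (a <= n)%N -> (b <= n)%N ->
  Rcoef n.+1 (n - j) (n - i) (n - b) (n - a)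
    * (qbinom_scale n.+1 i * qbinom_scale n.+1 j)
  = qbinom_scale n.+1 a * qbinom_scale n.+1 b * Rcoef n.+1 i j a b.
Proof.
move=> hi hj ha hb.
case c: ((a + b == i + j)%N && (j <= a)%N); last first.
  rewrite !Rcoef_eq0 ?mulr0 ?mul0r ?c //; apply/negP => /andP [/eqP e le].
  move/negbT: c => /negP; apply; apply/andP; split; [apply/eqP|]; lia.
case/andP: c => /eqP e ja.
have [m [ea ei]] : exists m, a = (j + m)%N /\ i = (b + m)%N by exists (a - j)%N; lia.
rewrite (Rcoef_shift _ _ _ _ _ m); try lia.
rewrite (Rcoef_shift _ i j a b m) // [in X in _ * X]ei [X in _ = X * _ * _](_ : _ =
  qbinom_scale n.+1 (j + m)); last by rewrite ea.
rewrite !qbinom_scale_add.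
have -> : \prod_(t < m) (qint (b + t).+1 * qint (n.+1 - (b + t).+1)) =
          \prod_(t < m) (qint (i - t) * qint (n.+1 - i + t)).
  rewrite (reindex_inj rev_ord_inj) /=; apply: eq_bigr => t _.
  by have := ltn_ord t => tm; congr (qint _ * qint _); lia.
have -> : \prod_(t < m) (qint (n - j - t) * qint (n.+1 - (n - j) + t)) =
          \prod_(t < m) (qint (j + t).+1 * qint (n.+1 - (j + t).+1)).
  apply: eq_bigr => t _; rewrite mulrC.
  by have := ltn_ord t => tm; congr (qint _ * qint _); lia.
have -> : (n.+1%:Z - 1 - 2 * (n - a)%N%:Z) * (n.+1%:Z - 1 - 2 * (n - b)%N%:Z) =
          (n.+1%:Z - 1 - 2 * b%:Z) * (n.+1%:Z - 1 - 2 * a%:Z).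
  rewrite -!subzn // intS; ring.
ring.
Qed.

Lemma diag_high n s : (s <= n)%N ->
  forall p k, invmx_exp (Rmat n.+1) p (high_idx n s k) (high_idx n s k)
              = invmx_exp (weight_block n.+1 s) p k k.
Proof.
move=> sn.
case: (@diag_block F _ _ (Rmat n.+1) (weight_block n.+1 s) (high_idx n s)
  (fun k => qbinom_scale n.+1 k * qbinom_scale n.+1 (s - k))) => //.
- exact: Rmat_unitmx.
- exact: high_idx_inj.
- by move=> k; have := ltn_ord k => h; apply: mulf_neq0; apply: qbinom_scale_neq0; lia.
- move=> l k; have := ltn_ord k; have := ltn_ord l => hl hk.
  rewrite !mxE !high_idxE //; apply: Rcoef_flip; lia.
move=> x k xf; rewrite mxE !high_idxE // Rcoef_eq0 //.
apply/negP => /andP [/eqP e _]; have /eqP := xf (inord (n - x %% n.+1)); apply.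
by apply: eq_high_idx => //; rewrite e; have := ltn_ord k; lia.
Qed.

(** The weight [n] is its own mirror image; the second sum stops at [s < n] so that it is counted
    once. *)
Lemma sum_by_weight (V : zmodType) n (G : 'I_(n.+1 * n.+1) -> V) :
  \sum_x G x = \sum_(s < n.+1) \sum_(k < s.+1) G (low_idx n s k)
             + \sum_(s < n) \sum_(k < s.+1) G (high_idx n s k).
Proof.
pose wt (x : 'I_(n.+1 * n.+1)) := (x %/ n.+1 + x %% n.+1)%N.
have wt_lt x : (wt x <= n + n)%N.
  by have := ltn_div_sq _ x; have := ltn_mod_sq _ x; rewrite /wt; lia.
rewrite (bigID (fun x => (wt x <= n)%N)) /=; congr (_ + _).
  rewrite (partition_big (fun x => inord (wt x) : 'I_n.+1) xpredT) //=.
  apply: eq_bigr => s _; have sn : (s <= n)%N by rewrite -ltnS.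
  rewrite (reindex (low_idx n s)) /=; last first.
    exists (fun x => inord (x %/ n.+1)) => x.
      by rewrite low_idxE // inord_val.
    rewrite inE => /andP [le_n /eqP e]; rewrite -eq_low_idx // -/(wt x).
    by rewrite -e inordK.
  apply: eq_bigl => k; rewrite /wt !low_idxE //.
  by rewrite subnKC ?sn ?inord_val ?eqxx // -ltnS.
(* [inord] needs a nonempty ordinal type; for [n = 0] there is no high weight. *)
case: n G @wt wt_lt => [|n] G wt wt_lt.
  by rewrite big_ord0 big1 // => x; have := wt_lt x; rewrite leqn0 => /eqP ->.
rewrite (partition_big (fun x => inord (n.+1 + n.+1 - wt x) : 'I_n.+1) xpredT) //=.
apply: eq_bigr => s _; have sn : (s < n.+1)%N by [].
rewrite (reindex (high_idx n.+1 s)) /=; last first.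
  exists (fun x => inord (n.+1 - x %% n.+2)) => x.
    move=> _; apply: val_inj; rewrite high_idxE ?(ltnW sn) //=.
    by have := ltn_ord x => xs; rewrite inordK; lia.
  rewrite inE => /andP [gt_n /eqP e]; rewrite -eq_high_idx ?(ltnW sn) // -/(wt x).
  by have := wt_lt x; rewrite -e inordK; lia.
apply: eq_bigl => k; have := ltn_ord k => ks; rewrite /wt !high_idxE ?(ltnW sn) //.
apply/andP; split; first by lia.
by apply/eqP/val_inj; rewrite /= inordK; lia.
Qed.

(** * Quantum trace and tail *)

Lemma qtrace_invmx_exp n p :
  qtrace n.+1 (invmx_exp (Rmat n.+1) p) =
  \sum_(s < n.+1) wpow (4 * (n%:Z - s%:Z)) * \sum_(r < s.+1) R_eigenvalue n.+1 r ^- p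
  + \sum_(s < n) wpow (- (4 * (n%:Z - s%:Z))) * \sum_(r < s.+1) R_eigenvalue n.+1 r ^- p.
Proof.
have tr_blk s : (s <= n)%N ->
    \sum_(k < s.+1) invmx_exp (weight_block n.+1 s) p k k = \sum_(r < s.+1) R_eigenvalue n.+1 r ^- p.
  move=> sn; apply: mxtrace_weight_block => // r rs.
  by have [] := diag_low n r (leq_trans rs sn).
rewrite /qtrace sum_by_weight; congr (_ + _); apply: eq_bigr => s _.
  have sn : (s <= n)%N by rewrite -ltnS.
  rewrite -(tr_blk _ sn) mulr_sumr; apply: eq_bigr => k _.
  rewrite (proj2 (diag_low n s sn)) !low_idxE //; congr (wpow _ * _).
  have ks : (k <= s)%N by rewrite -ltnS.
  rewrite -!subzn // intS; ring.
have sn : (s <= n)%N by apply: ltnW.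
rewrite -(tr_blk _ sn) mulr_sumr; apply: eq_bigr => k _.
rewrite (diag_high n s sn) !high_idxE //; congr (wpow _ * _).
have ks : (k <= s)%N by rewrite -ltnS.
rewrite -!subzn ?(leq_trans (leq_subr _ _) sn) ?(leq_trans ks sn) // intS; ring.
Qed.

(** [vdiff] times the quantum dimension [[2d+1]]; an integer [d] lets the Abel summation step down
    freely. *)
Definition wanti (d : int) : F := wpow (2 * (2 * d + 1)) - wpow (- (2 * (2 * d + 1))).

Lemma wanti_sub d : vdiff * (wpow (4 * d) + wpow (- (4 * d))) = wanti d - wanti (d - 1).
Proof.
have -> : vdiff = wpow 2 - wpow (-2) by [].
have -> : wanti d - wanti (d - 1) = wpow (2 + 4 * d) + wpow (2 + - (4 * d))
            - (wpow (-2 + 4 * d) + wpow (-2 + - (4 * d))).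
  rewrite /wanti.
  have -> : 2 * (2 * d + 1) = 2 + 4 * d by ring.
  have -> : 2 * (2 * (d - 1) + 1) = -2 + 4 * d by ring.
  have -> : - (2 + 4 * d) = -2 + - (4 * d) by ring.
  have -> : - (-2 + 4 * d) = 2 + - (4 * d) by ring.
  ring.
rewrite !wpowD; ring.
Qed.

Lemma abel_wanti (n : nat) (mu : nat -> F) (m : nat) :
  vdiff * \sum_(s < m) ((wpow (4 * (n%:Z - s%:Z)) + wpow (- (4 * (n%:Z - s%:Z))))
                        * \sum_(r < s.+1) mu r)
  = \sum_(r < m) wanti (n%:Z - r%:Z) * mu r - wanti (n%:Z - m%:Z) * \sum_(r < m) mu r.
Proof.
elim: m => [|m IH]; first by rewrite !big_ord0 !mulr0 subrr.
rewrite !big_ord_recr /= mulrDr IH mulrA wanti_sub.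
have -> : n%:Z - m.+1%:Z = n%:Z - m%:Z - 1 by rewrite intS; ring.
ring.
Qed.

(** The expansion of the quantum trace over the irreducible summands of [V_N (x) V_N]: quantum
    dimension times power of the eigenvalue. *)
Lemma vdiff_qtrace n p :
  vdiff * qtrace n.+1 (invmx_exp (Rmat n.+1) p) =
  \sum_(r < n.+1) wanti (n%:Z - r%:Z) * R_eigenvalue n.+1 r ^- p.
Proof.
rewrite qtrace_invmx_exp big_ord_recr /= subrr mulr0 wpow0 mul1r.
rewrite addrAC -big_split /=.
under eq_bigr => s _ do rewrite -mulrDl.
(* Since [wanti 0 = vdiff], the middle block [s = n] cancels the boundary term of the Abel summation
   and leaves the summand [r = n]. *)
rewrite mulrDr (abel_wanti n (fun r => R_eigenvalue n.+1 r ^- p)) subrr.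
rewrite !big_ord_recr /= subrr (_ : wanti 0 = vdiff); last by [].
ring.
Qed.

Lemma R_eigenvalue_even N r k :
  R_eigenvalue N r ^- (2 * k) =
  wpow (- (2 * k%:Z * ((N%:Z - 1) * (N%:Z - 1 - 2 * r%:Z) - 2 * r%:Z * (N%:Z - r%:Z)))).
Proof.
rewrite /R_eigenvalue exprMn wpow_exp [(_ ^+ r) ^+ _]exprAC exprM sqrrN !expr1n mul1r -wpowN.
by congr wpow; rewrite PoszM; ring.
Qed.

(** * Numerator polynomial and the false theta series *)

Definition expo_pos (k c : nat) : nat := k * (c * c.+1) - c.
Definition expo_neg (k c : nat) : nat := k * (c * c.+1) + c.+1.

Lemma expo_posE k c : (0 < k)%N -> (expo_pos k c)%:Z = k%:Z * (c%:Z * (c%:Z + 1)) - c%:Z.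
Proof.
move=> k0; rewrite /expo_pos -subzn; last by rewrite mulnCA leq_pmulr ?muln_gt0 ?k0.
by rewrite !PoszM intS; ring.
Qed.

Lemma expo_negE k c : (expo_neg k c)%:Z = k%:Z * (c%:Z * (c%:Z + 1)) + c%:Z + 1.
Proof. by rewrite /expo_neg PoszD !PoszM intS; ring. Qed.

(** Truncation of [Psi(q^(2k-1), q)] to [N] terms of each sign, the negative terms being reindexed
    by [m = c + 1]. *)
Definition tail_num (k N : nat) : {poly int} :=
  \sum_(c < N) ('X^(expo_pos k c) - 'X^(expo_neg k c)).

Lemma dvd_1subXn (N i j t : nat) : j = (i + N * t)%N ->
  exists q : {poly int}, 'X^i - 'X^j = (1 - 'X^N) * q.
Proof.
move=> ->; exists ('X^i * \sum_(u < t) ('X^N) ^+ u).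
rewrite mulrCA -[1 - _]opprB mulNr -subrX1 opprB mulrBr mulr1.
by rewrite -exprM -exprD.
Qed.

(* Modulo N, [expo_pos k c] equals [expo_neg k (N-1-c)]. *)
Lemma tail_num_dvd k N : (0 < k)%N -> exists q : {poly int}, tail_num k N = (1 - 'X^N) * q.
Proof.
move=> k0; case: N => [|n].
  by exists 0; rewrite mulr0 /tail_num big_ord0.
rewrite /tail_num sumrB [X in _ - X](reindex_inj rev_ord_inj) -sumrB /=.
elim/big_ind: _ => [|x y [p ->] [q ->]|c _].
- by exists 0; rewrite mulr0.
- by exists (p + q); rewrite mulrDr.
have cn : (c <= n)%N by rewrite -ltnS.
have e : (expo_neg k (n - c))%:Z =
    (expo_pos k c)%:Z + n.+1%:Z * (k%:Z * (n%:Z - 2 * c%:Z) + 1).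
  by rewrite expo_posE // expo_negE -subzn // intS; ring.
(* For [2c <= n] the multiple of [n+1] in [e] is nonnegative; otherwise [k(2c - n) - 1 >= 0] and the
   two monomials exchange roles. *)
rewrite subSS; have [le_c|lt_c] := leqP (c + c) n.
  apply: (dvd_1subXn _ _ _ (k * (n - (c + c)) + 1)); apply/eqP; rewrite -eqz_nat e.
  by rewrite PoszD !PoszM PoszD PoszM -subzn // PoszD; apply/eqP; ring.
have [q Dq] : exists q : {poly int},
    'X^(expo_neg k (n - c)) - 'X^(expo_pos k c) = (1 - 'X^(n.+1)) * q.
  apply: (dvd_1subXn _ _ _ (k * (c + c - n) - 1)); apply/eqP; rewrite -eqz_nat.
  rewrite PoszD PoszM -subzn ?muln_gt0 ?k0 ?subn_gt0 // PoszM -subzn 1?ltnW // e PoszD.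
  by apply/eqP; ring.
by exists (- q); rewrite mulrN -Dq opprB.
Qed.

Lemma bin2_double m : ('C(m.+1, 2) * 2 = m * m.+1)%N.
Proof. by elim: m => [//|m IH]; rewrite binS bin1 mulnDl IH; lia. Qed.

Lemma bin2_recr m : ('C(m.+1, 2) = 'C(m, 2) + m)%N.
Proof. by rewrite binS bin1. Qed.

Lemma psi_expo_pos k m : (0 < k)%N ->
  ((2 * k - 1) * 'C(m.+1, 2) + 1 * 'C(m, 2) = expo_pos k m)%N.
Proof.
move=> k0; rewrite /expo_pos -bin2_double bin2_recr.
have : (m <= 'C(m, 2) + m)%N by rewrite leq_addl.
move: 'C(m, 2) => b _; case: k k0 => // k _.
have -> : (2 * k.+1 - 1 = k * 2 + 1)%N by lia.
nia.
Qed.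

Lemma psi_expo_neg k c : (0 < k)%N ->
  ((2 * k - 1) * 'C(c.+1, 2) + 1 * 'C(c.+2, 2) = expo_neg k c)%N.
Proof.
move=> k0; rewrite /expo_neg -bin2_double (bin2_recr c.+1).
move: 'C(c.+1, 2) => b; case: k k0 => // k _.
have -> : (2 * k.+1 - 1 = k * 2 + 1)%N by lia.
nia.
Qed.

(** No index beyond [i] can hit the exponent [i], so the truncation at [N] terms and the one in
    [psi_coef] agree. *)
Lemma sum_hits_stable (e : nat -> nat) (i m : nat) : (forall c, c <= e c)%N -> (i < m)%N ->
  \sum_(c < m) (nat_of_bool (e c == i)%N)%:Z = \sum_(c < i.+1) (nat_of_bool (e c == i)%N)%:Z.
Proof.
move=> le_e im; rewrite -!(big_mkord xpredT (fun c => (nat_of_bool (e c == i)%N)%:Z)).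
rewrite (big_cat_nat _ (n := i.+1)) //= [X in _ + X]big_nat_cond [X in _ + X]big1 ?addr0 //.
move=> c /andP [/andP [ic _] _]; rewrite gtn_eqF //.
exact: leq_trans ic (le_e c).
Qed.

Lemma leq_expo_pos k c : (0 < k)%N -> (c <= expo_pos k c)%N.
Proof. by case: k => // k _; rewrite /expo_pos; case: c => // c; nia. Qed.

Lemma leq_expo_neg k c : (c <= expo_neg k c)%N.
Proof. by rewrite /expo_neg; lia. Qed.

Lemma tail_num_psi k N i : (0 < k)%N -> (i < N)%N ->
  (tail_num k N)`_i = psi_coef (2 * k - 1) 1 i.
Proof.
move=> k0 iN; rewrite /tail_num /psi_coef sumrB coefB !coef_sum big_mkord.
have mon (e : nat -> nat) : \sum_(c < N) ('X^(e c) : {poly int})`_i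
    = \sum_(c < N) (nat_of_bool (e c == i)%N)%:Z.
  by apply: eq_bigr => c _; rewrite coefXn eq_sym natz.
rewrite !mon big_add1 big_mkord /=; congr (_ - _).
  rewrite sum_hits_stable => [|c|//]; last exact: leq_expo_pos.
  (* The positive sum of [psi_coef] has [i+2] terms; the negative one has [i+1] after its shift and
     needs no such adjustment. *)
  rewrite -(sum_hits_stable _ i i.+2) => [|c|//]; last exact: leq_expo_pos.
  by apply: eq_bigr => c _; rewrite psi_expo_pos.
rewrite sum_hits_stable => [|c|//]; last exact: leq_expo_neg.
by apply: eq_bigr => c _; rewrite psi_expo_neg.
Qed.

Lemma braidpow_neg N k : (0 < k)%N -> braidpow N (- (2 * k)%:Z) = invmx_exp (Rmat N) (2 * k).
Proof. by case: k => // k _; rewrite mulnS. Qed.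

(** In units of [q^(1/2)]: the framing factor and the eigenvalue power at [r = N-1] each contribute
    [q^(-k(N^2-1)/2)], and [1 - N] removes the leading power of [1/[N]]. *)
Definition shift_exp (k N : nat) : int := 2 * k%:Z * ((N * N)%:Z - 1) + 1 - N%:Z.

(** Up to a power of [q], [1 - q^N] is [[N] vdiff], which clears the normalization and prepares
    [vdiff_qtrace]. *)
Lemma cjones_tail k n : (0 < k)%N ->
  (1 - wpow (- (4 * n.+1%:Z))) *
    (wpow (- (2 * shift_exp k n.+1)) * cjones_2braid n.+1 (- (2 * k)%:Z))
  = \sum_(c < n.+1) (wpow (- (4 * (expo_pos k c)%:Z)) - wpow (- (4 * (expo_neg k c)%:Z))).
Proof.
have cancel (K : fieldType) (x q v A B T : K) : q != 0 ->
    x * (q * v) * (A * (B * T / q)) = x * A * B * (v * T) by move=> q0; field.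
move=> k0; rewrite /cjones_2braid braidpow_neg //.
have q0 : qint n.+1 != 0 by apply: qint_neq0.
have -> : 1 - wpow (- (4 * n.+1%:Z)) = wpow (- (2 * n.+1%:Z)) * (qint n.+1 * vdiff).
  rewrite qint_vdiff mulrBr -!wpowD -wpow0; congr (wpow _ - wpow _); ring.
set T := qtrace _ _; set A := wpow (- (2 * shift_exp _ _)); set B := wpow (- (_ * _)).
(* After the reversal [c = n - r], the index labels the summand of dimension [2c+1]; the two terms
   of [wanti] give the two exponents. *)
rewrite cancel // vdiff_qtrace mulr_sumr (reindex_inj rev_ord_inj); apply: eq_bigr => c _ /=.
have cn : (c <= n)%N by rewrite -ltnS.
rewrite R_eigenvalue_even subSS mulrBl mulrBr /A /B -!wpowD.
rewrite expo_posE // expo_negE /shift_exp !PoszM -!subzn // !intS.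
by congr (wpow _ - wpow _); ring.
Qed.

Lemma wpow_comp (m : nat) : wpow (- (4 * m%:Z)) = tofrac ('X^m \Po 'X^4 : {poly int}).
Proof. by rewrite comp_Xn_poly -exprM -[4 * m%:Z](PoszM 4) wpow_tofrac. Qed.

Lemma Xq_wpow z : Xq ^ z = wpow (- z).
Proof. by rewrite -[in LHS](invrK Xq) exprz_inv. Qed.

Theorem mainTheorem5 (k : nat) : (1 <= k)%N ->
  forall N : nat, (1 <= N)%N ->
    doteq N (cjones_2braid N (- (2 * k)%:Z)) (psi_coef (2 * k - 1) 1).
Proof.
move=> k0 [//|n] _; have [p Dp] := tail_num_dvd k n.+1 k0.
exists false, (shift_exp k n.+1), p; split=> [|i iN]; last first.
  (* The numerator is [p - X^N p], so it has the coefficients of [p] below degree [N]. *)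
  by rewrite -(tail_num_psi _ _ _ k0 iN) Dp mulrBl mul1r coefB coefXnM iN subr0.
have cE : 1 - wpow (- (4 * n.+1%:Z)) = tofrac ((1 - 'X^(n.+1)) \Po 'X^4 : {poly int}).
  by rewrite wpow_comp comp_polyB comp_polyC tofracB tofrac1.
have c0 : 1 - wpow (- (4 * n.+1%:Z)) != 0.
  rewrite subr_eq0 wpowN eq_sym invr_eq1 -[4 * n.+1%:Z](PoszM 4).
  exact: wpow_neq1.
rewrite expr0 mul1r Xq_wpow; apply: (mulfI c0).
rewrite cjones_tail // cE -tofracM -comp_polyM -Dp.
rewrite /tail_num linear_sum rmorph_sum /=; apply: eq_bigr => c _.
by rewrite comp_polyB tofracB !wpow_comp.
Qed.
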